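(* Let $\beta\in\mathbb{C}$. If $\eta(\beta)\neq 0$, then $\beta$ is an algebraic integer. Moreover, if $\beta$ is an algebraic integer, then $\eta(\beta)=\deg(p)^{-1}$, where $p$ is the minimal polynomial of $\beta$.
   Context: For $\mu_0\in\mathbb{C}$ and $r>0$ let $B(\mu_0,r)=\{\mu\in\mathbb{C}\mid |\mu-\mu_0|\le r\}$. For $\lambda>0$ let $P(\lambda)$ be the set of non-constant monic polynomials with coefficients in $\mathbb{Z}$ all of whose complex zeros lie in $B(0,\lambda)$. For $\beta\in\mathbb{C}$, $\epsilon>0$ and $p\in P(\lambda)$ let $Z(\beta,\epsilon,p)$ be the number of zeros of $p$, counted with multiplicity, lying in $B(\beta,\epsilon)$. Define $$\eta(\beta,\lambda)=\sup\{\delta\ge 0\mid \forall\,\epsilon>0\ \exists\,p\in P(\lambda):\ Z(\beta,\epsilon,p)/\deg(p)\ge\delta\},\qquad \eta(\beta)=\sup\{\eta(\beta,\lambda)\mid\lambda>0\}.$$ *)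

(* Defs.v *)
From mathcomp Require Export all_boot all_order all_algebra.
From mathcomp Require Export all_classical all_reals.
From mathcomp Require Export complex.

Set Implicit Arguments.
Unset Strict Implicit.
Unset Printing Implicit Defensive.
Import Order.TTheory GRing.Theory Num.Theory.
Local Open Scope classical_set_scope.
Local Open Scope complex_scope.
Local Open Scope ring_scope.

(* The field of complex numbers is [R[i]] for [R : realType]; its norm takes
   values in [R[i]], hence the embedding [_%:C] of the radius. *)
Definition cdisc (R : realType) (c : R[i]) (r : R) : set R[i] :=
  [set z | `|z - c| <= r%:C].

Definition deg (A : nzRingType) (p : {poly A}) : nat := (size p).-1.

Definition Cpoly (R : realType) (p : {poly int}) : {poly R[i]} :=
  map_poly intr p.

Definition Pset (R : realType) (lambda : R) : set {poly int} :=
  [set p | [/\ p \is monic, (0 < deg p)%N &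
     forall z : R[i], root (Cpoly R p) z -> cdisc 0 lambda z]].

(* The roots listed with multiplicity: for monic [p], the product of the
   ['X - z%:P] over this list is [p], see [zerosE]. *)
Definition zeros (R : realType) (p : {poly int}) : seq R[i] :=
  sval (closed_field_poly_normal (Cpoly R p)).

Definition Zcount (R : realType) (beta : R[i]) (eps : R) (p : {poly int}) : nat :=
  count (fun z => `[< cdisc beta eps z >]) (zeros R p).

(* [sup] is 0 on sets that are empty or unbounded above; both sets below are
   nonempty and bounded above, see [has_sup_eta_at] and [has_sup_eta]. *)
Definition eta_at_set (R : realType) (beta : R[i]) (lambda : R) : set R :=
  [set delta | 0 <= delta /\
     forall eps : R, 0 < eps -> exists2 p, Pset lambda p &
       delta <= (Zcount beta eps p)%:R / (deg p)%:R].

Definition eta_at (R : realType) (beta : R[i]) (lambda : R) : R :=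
  sup (eta_at_set beta lambda).

Definition eta_set (R : realType) (beta : R[i]) : set R :=
  [set eta_at beta lambda | lambda in [set lambda : R | 0 < lambda]].

Definition eta (R : realType) (beta : R[i]) : R := sup (eta_set beta).

Definition algebraic_integer (R : realType) (beta : R[i]) : Prop :=
  integralOver (intr : int -> R[i]) beta.

Definition minimal_polynomial (R : realType) (beta : R[i])
    (p : {poly rat}) : Prop :=
  [/\ p \is monic, root (map_poly ratr p) beta &
     forall q : {poly rat}, q \is monic -> root (map_poly ratr q) beta ->
       (deg p <= deg q)%N].

Lemma Cpoly_monic (R : realType) (p : {poly int}) :
  p \is monic -> Cpoly R p \is monic.
Proof. exact: monic_map. Qed.

Lemma zerosE (R : realType) (p : {poly int}) : p \is monic ->
  Cpoly R p = \prod_(z <- zeros R p) ('X - z%:P).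
Proof.
move=> /(Cpoly_monic R)/monicP lp.
rewrite /zeros; case: closed_field_poly_normal => s /= {1}->.
by rewrite lp scale1r.
Qed.

Lemma size_zeros (R : realType) (p : {poly int}) : p \is monic ->
  size (zeros R p) = deg p.
Proof.
move=> pm; have := zerosE R pm; move/(congr1 (fun q : {poly _} => size q)).
rewrite size_prod_XsubC /Cpoly size_map_inj_poly//.
- by rewrite /deg => ->.
- exact: intr_inj.
Qed.

Lemma Pset_X (R : realType) (lambda : R) : 0 < lambda -> Pset lambda 'X.
Proof.
move=> l0; split; [exact: monicX|by rewrite /deg size_polyX|].
move=> z; rewrite /Cpoly map_polyX rootX => /eqP ->.
by rewrite /cdisc /= subr0 normr0 lecR ltW.
Qed.

Lemma has_sup_eta_at (R : realType) (beta : R[i]) (lambda : R) :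
  0 < lambda -> has_sup (eta_at_set beta lambda).
Proof.
move=> l0; split.
  exists 0; split=> // eps _; exists 'X; first exact: Pset_X.
  by rewrite divr_ge0.
exists 1 => d [_ /(_ 1 ltr01)[p [pm p0 _]]] /le_trans; apply.
rewrite ler_pdivrMr ?ltr0n// mul1r ler_nat -(size_zeros R pm).
exact: count_size.
Qed.

Lemma has_sup_eta (R : realType) (beta : R[i]) : has_sup (eta_set beta).
Proof.
split; first by exists (eta_at beta 1), 1 => //=.
exists 1 => _ [l /= l0 <-].
have [ne _] := has_sup_eta_at beta l0.
apply: ge_sup => // d [_ /(_ 1 ltr01)[p [pm p0 _]]] /le_trans; apply.
rewrite ler_pdivrMr ?ltr0n// mul1r ler_nat -(size_zeros R pm).
exact: count_size.
Qed.

Lemma minimal_polynomial_exists_unique (R : realType) (beta : R[i]) :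
  algebraic_integer beta -> exists! p, minimal_polynomial beta p.
Proof.
move=> [p0 p0m rp0].
pose Q n := `[< exists q : {poly rat},
  [/\ q \is monic, root (map_poly ratr q) beta & deg q = n] >].
have exQ : exists n, Q n.
  exists (deg (map_poly intr p0 : {poly rat})); apply/asboolP.
  exists (map_poly intr p0); split=> //; first exact: monic_map.
  rewrite -map_poly_comp (_ : map_poly _ p0 = map_poly intr p0)//.
  by apply: eq_map_poly => z /=; rewrite rmorph_int.
case: (ex_minnP exQ) => n /asboolP[p [pm rp dp]] nmin.
have mp : minimal_polynomial beta p.
  split=> // q qm rq; rewrite dp; apply: nmin.
  by apply/asboolP; exists q.
exists p; split=> // q [qm rq qmin].
have dq : deg p = deg q.
  by apply/eqP; rewrite eqn_leq qmin//; case: mp => _ _ ->.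
have [//|pq] := eqVneq p q; exfalso.
have d0 : p - q != 0 by rewrite subr_eq0.
have sp : size p = (deg p).+1.
  by rewrite /deg prednK// size_poly_gt0 monic_neq0.
have sq : size q = (deg p).+1.
  by rewrite dq /deg prednK// size_poly_gt0 monic_neq0.
have ld : (size (p - q)%R <= deg p)%N.
  apply/leq_sizeP => j; rewrite leq_eqVlt coefB => /predU1P[<-|lt].
    move/monicP: pm; move/monicP: qm.
    by rewrite /lead_coef sp sq /= => -> ->; rewrite subrr.
  by rewrite !nth_default ?sp ?sq// subrr.
pose r := (lead_coef (p - q))^-1 *: (p - q).
have rm : r \is monic by rewrite monicE lead_coefZ mulVf ?lead_coef_eq0.
case: mp => _ _ /(_ r rm).
rewrite {1}/root /r linearZ/= hornerZ rmorphB/= hornerD hornerN.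
rewrite (rootP rp) (rootP rq) subrr mulr0 eqxx => /(_ isT).
rewrite /deg size_scale ?invr_eq0 ?lead_coef_eq0// -[X in (X <= _)%N]/(deg p).
move: ld; have := d0; rewrite -size_poly_gt0.
by case: (size (p - q)) => //= k _ /leq_trans H /H; rewrite ltnn.
Qed.

(* Main.v *)
Require Import Defs.
From mathcomp Require Import zify ring lra.
Import Order.TTheory GRing.Theory Num.Theory.
Local Open Scope ring_scope.

(** The source of rigidity is the resultant. If [p] is a monic and [q] any
    integer polynomial without common complex zero, the product of the values
    of [q] at the zeros of [p] is a nonzero integer, so its modulus is at least
    1. Let [M >= 1] bound [q] on the disc that contains the zeros of [p], and
    let [q] be so small at [beta] that [|q(beta)| M^N < 1]. If at least one
    in [N] of the zeros of [p] were close to [beta], the product would be less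
    than 1. Hence
    such a [p] has fewer than [deg p / N] zeros near [beta]
    ([Zcount_sparse], [sparse_near]).

    If [beta] is not an algebraic integer, polynomials [q] of this kind exist
    for every [N] by the pigeonhole principle ([small_int_poly]), whether [beta]
    is transcendental or algebraic. The zeros that [p] shares with [q] do no
    harm: those near [beta] could only be [beta] itself, which is a zero of no
    monic integer polynomial, and the others can be divided out of [p] over the
    integers ([split_common_zeros]). So no positive density is attained
    ([algebraic_integer_of_density]).

    If [beta] is an algebraic integer with minimal polynomial [m], then [m] has
    integer coefficients and its density of zeros at [beta] is [1 / deg m], as
    [beta] is a simple zero. Conversely write [p = m^k h] with [h] nonzero at
    [beta]. Then [m], which vanishes at [beta], serves as [q] for [h] and every
    [N]: the zeros of [h] near [beta] have density as small as desired, so the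
    density of [p] cannot exceed [1 / deg m] in the limit
    ([density_le_minimal]). *)

Set Implicit Arguments.
Unset Strict Implicit.
Unset Printing Implicit Defensive.

(** * The product of the values of q at the zeros of p *)

Lemma horner_char_poly (F : comNzRingType) (n : nat) (A : 'M[F]_n) (w : F) :
  (char_poly A).[w] = \det (w%:M - A).
Proof.
have -> : w%:M - A = map_mx (horner_eval w) (char_poly_mx A).
  apply/matrixP => i j; rewrite !mxE /= /horner_eval hornerD hornerN hornerMn.
  by rewrite hornerX hornerC.
by rewrite det_map_mx.
Qed.

(** Splitting [q] into linear factors reduces this to [det (A - w)], which is
    [char_poly A] at [w] up to sign; exchanging the two products then collects
    the factors of [q] at each eigenvalue. *)
Lemma det_horner_mx (F : closedFieldType) (n : nat) (A : 'M[F]_n.+1)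
    (s : seq F) (q : {poly F}) :
  char_poly A = \prod_(z <- s) ('X - z%:P) ->
  \det (horner_mx A q) = \prod_(z <- s) q.[z].
Proof.
move=> As; have sz : size s = n.+1.
  by have := size_char_poly A; rewrite As size_prod_XsubC => -[].
have prodX a : \prod_(z <- s) a = a ^+ size s.
  by rewrite big_const_seq count_predT iter_mulr_1.
have [r ->] := closed_field_poly_normal q.
set c := lead_coef q.
have detX w : \det (horner_mx A ('X - w%:P)) = \prod_(z <- s) (z - w).
  rewrite rmorphB /= horner_mx_X horner_mx_C -opprB -scaleN1r detZ.
  rewrite -horner_char_poly As horner_prod -sz -prodX -big_split /=.
  apply: eq_bigr => z _; by rewrite hornerXsubC mulN1r opprB.
rewrite linearZ /= detZ rmorph_prod /=.
rewrite (big_morph (fun B : 'M[F]_n.+1 => \det B) (@det_mulmx _ _) (det1 _ _)).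
under eq_bigr do rewrite detX.
rewrite exchange_big /= -sz -prodX -big_split /=.
apply: eq_bigr => z _; rewrite hornerZ horner_prod; congr (_ * _).
by apply: eq_bigr => w _; rewrite hornerXsubC.
Qed.

(** The product is the resultant of [p] and [q]; it is an integer because it is
    the determinant of [q] evaluated at the companion matrix of [p], a matrix
    with integer entries. *)
Lemma prod_horner_zeros_int (R : realType) (p q : {poly int}) :
  p \is monic -> (0 < deg p)%N ->
  exists k : int, \prod_(z <- zeros R p) (Cpoly R q).[z] = k%:~R.
Proof.
move=> pm p0; have := companionmxK pm; move: (companionmx p).
move: p0; rewrite /deg; case: (size p).-1 => // n _ A Ap.
exists (\det (horner_mx A q)).
rewrite -det_map_mx map_horner_mx; apply/esym/det_horner_mx.
by rewrite -map_char_poly Ap -zerosE.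
Qed.

(** * Splitting off common zeros over the integers *)

Lemma CpolyM (R : realType) (p q : {poly int}) :
  Cpoly R (p * q) = Cpoly R p * Cpoly R q.
Proof. exact: rmorphM. Qed.

Lemma CpolyD (R : realType) (p q : {poly int}) :
  Cpoly R (p + q) = Cpoly R p + Cpoly R q.
Proof. exact: rmorphD. Qed.

Lemma root_CpolyZ (R : realType) (c : int) (p : {poly int}) (z : R[i]) :
  c != 0 -> root (Cpoly R (c *: p)) z = root (Cpoly R p) z.
Proof. by move=> c0; rewrite /Cpoly map_polyZ rootZ ?intr_eq0. Qed.

(** The factor [g] is the primitive part of the greatest common divisor of [p]
    and [q]. By the lemma of Gauss it divides [p] over the integers, hence is
    monic like [p]; the Bezout relation shows that it keeps the zero [z]. *)
Lemma common_factor (R : realType) (p q : {poly int}) (z : R[i]) :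
  p \is monic -> q != 0 -> root (Cpoly R p) z -> root (Cpoly R q) z ->
  exists g h : {poly int}, [/\ p = g * h, g \is monic /\ h \is monic,
    root (Cpoly R g) z, (size g <= size q)%N &
    forall w : R[i], root (Cpoly R g) w -> root (Cpoly R q) w].
Proof.
move=> pm q0 pz qz; have p0 := monic_neq0 pm.
have g0 : gcdp p q != 0 by rewrite gcdp_eq0 (negbTE p0).
have c0 : zcontents (gcdp p q) != 0 by rewrite zcontents_eq0.
have gE w : root (Cpoly R (zprimitive (gcdp p q))) w
    = root (Cpoly R (gcdp p q)) w.
  by rewrite [in RHS](zpolyEprim (gcdp p q)) root_CpolyZ.
have [h ph] := dvdpP_int (dvdp_gcdl p q).
exists (zprimitive (gcdp p q)), h.
have lc : lead_coef (zprimitive (gcdp p q)) * lead_coef h = 1.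
  by rewrite -lead_coefM -ph (monicP pm).
have lg : lead_coef (zprimitive (gcdp p q)) = 1.
  have := sgz_lead_primitive (gcdp p q); rewrite g0 => /eqP; rewrite sgz_cp0.
  have one_of_unit (a b : int) : a * b = 1 -> 0 < a -> a = 1.
    move=> /(congr1 absz) /eqP; rewrite abszM muln_eq1 => /andP[/eqP a1 _].
    by lia.
  exact: one_of_unit lc.
have gm : zprimitive (gcdp p q) \is monic by rewrite monicE lg.
split=> //.
- by split=> //; rewrite monicE -lc lg mul1r.
- rewrite gE; have [[u v] /= gcdE] := Bezoutp p q.
  have /Pdiv.CommonIdomain.eqpP[[a b] /= /andP[a0 b0] e] := gcdE.
  rewrite -(root_CpolyZ _ _ b0) -e root_CpolyZ // /root CpolyD !CpolyM.
  by rewrite !hornerE (rootP pz) (rootP qz) !mulr0 addr0.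
- by rewrite size_zprimitive dvdp_leq ?dvdp_gcdr.
- move=> w; rewrite gE => gw.
  have /Pdiv.Idomain.dvdpP[[a b] /= a0 e] := dvdp_gcdr p q.
  by rewrite -(root_CpolyZ _ _ a0) e CpolyM rootM gw orbT.
Qed.

Lemma monic_ind (P : {poly int} -> Prop) :
  (forall p, p \is monic ->
     (forall h, h \is monic -> (deg h < deg p)%N -> P h) -> P p) ->
  forall p, p \is monic -> P p.
Proof.
move=> IH p; have [n] := ubnP (deg p).
elim: n p => // n IHn p np pm; apply: IH => // h hm hp.
by apply: IHn => //; apply: leq_trans hp _.
Qed.

Lemma deg_monicM (g h : {poly int}) : g \is monic -> h \is monic ->
  deg (g * h) = (deg g + deg h)%N.
Proof.
move=> gm hm; rewrite /deg size_monicM ?monic_neq0 //.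
have := monic_neq0 gm; have := monic_neq0 hm; rewrite -!size_poly_gt0.
by case: (size g) => // a; case: (size h) => // b _ _; rewrite addnS.
Qed.

Lemma deg_root_gt0 (R : realType) (g : {poly int}) (z : R[i]) :
  g \is monic -> root (Cpoly R g) z -> (0 < deg g)%N.
Proof.
move=> gm gz; rewrite /deg -subn1 subn_gt0.
rewrite -(size_map_inj_poly (@intr_inj R[i]) (mulr0z _)).
exact: root_size_gt1 (monic_neq0 (Cpoly_monic R gm)) gz.
Qed.

Lemma zeros_root (R : realType) (p : {poly int}) (z : R[i]) :
  p \is monic -> (z \in zeros R p) = root (Cpoly R p) z.
Proof. by move=> pm; rewrite zerosE // root_prod_XsubC. Qed.

Lemma zeros_mul (R : realType) (g h : {poly int}) :
  g \is monic -> h \is monic ->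
  perm_eq (zeros R (g * h)) (zeros R g ++ zeros R h).
Proof.
move=> gm hm; apply: prod_XsubC_eq.
by rewrite big_cat /= -!zerosE ?monicMl // CpolyM.
Qed.

Lemma ZcountM (R : realType) (b : R[i]) (e : R) (g h : {poly int}) :
  g \is monic -> h \is monic ->
  Zcount b e (g * h) = (Zcount b e g + Zcount b e h)%N.
Proof.
by move=> gm hm; rewrite /Zcount (permP (zeros_mul R gm hm)) count_cat.
Qed.

(** Dividing [p] by one greatest common divisor with [q] may leave common zeros
    behind, when [p] has them with higher multiplicity; hence the induction. *)
Lemma split_common_zeros (R : realType) (q : {poly int}) : q != 0 ->
  forall p, p \is monic ->
  exists g h : {poly int}, [/\ p = g * h, g \is monic /\ h \is monic,
    forall w : R[i], root (Cpoly R g) w -> root (Cpoly R q) w &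
    forall w : R[i], root (Cpoly R h) w -> ~~ root (Cpoly R q) w].
Proof.
move=> q0; apply: monic_ind => p pm IH.
have [[z [pz qz]]|no] :=
    pselect (exists z : R[i], root (Cpoly R p) z /\ root (Cpoly R q) z);
    last first.
  exists 1, p; split; rewrite ?mul1r ?monic1 //.
    by move=> w; rewrite /Cpoly rmorph1 (negbTE (root1 _)).
  by move=> w pw; apply/negP => qw; apply: no; exists w.
have [g [h [ph [gm hm] gz _ gq]]] := common_factor pm q0 pz qz.
have [] := IH h hm.
  rewrite ph deg_monicM // -[X in (X < _)%N]add0n ltn_add2r.
  exact: deg_root_gt0 gm gz.
move=> g' [h' [hE [gm' hm'] gq' hq']].
exists (g * g'), h'; split=> //; first by rewrite ph hE mulrA.
  by rewrite monicMl.
by move=> w; rewrite CpolyM rootM => /orP[/gq|/gq'].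
Qed.

(** * The resultant bound *)

(** The values of [q] at the zeros of [p] multiply to a nonzero integer, so
    [1 <= s ^+ Z * M ^+ deg p] where [Z] zeros lie near [b]. If
    [deg p <= N * Z], the right-hand side is at most [(s * M ^+ N) ^+ Z < 1]. *)
Lemma Zcount_sparse (R : realType) (b : R[i]) (eps lambda : R) (N : nat)
    (s M : R[i]) (p q : {poly int}) :
  Pset lambda p ->
  (forall z : R[i], root (Cpoly R p) z -> ~~ root (Cpoly R q) z) ->
  0 <= s -> 1 <= M -> s * M ^+ N < 1 ->
  (forall z, cdisc b eps z -> `|(Cpoly R q).[z]| <= s) ->
  (forall z, cdisc 0 lambda z -> `|(Cpoly R q).[z]| <= M) ->
  (N * Zcount b eps p < deg p)%N.
Proof.
move=> [pm p0 plam] pq s0 M1 sM qs qM; rewrite ltnNge; apply/negP => nNZ.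
have Z0 : (0 < Zcount b eps p)%N.
  by move: (leq_trans p0 nNZ); rewrite muln_gt0 => /andP[].
have M0 : 0 <= M := le_trans ler01 M1.
have lo : 1 <= \prod_(z <- zeros R p) `|(Cpoly R q).[z]|.
  have [k kE] := prod_horner_zeros_int R q pm p0.
  have : \prod_(z <- zeros R p) (Cpoly R q).[z] != 0.
    by rewrite prodf_seq_neq0; apply/allP => z;
      rewrite zeros_root //; apply: pq.
  rewrite -normr_prod kE intr_eq0 -intr_norm ler1z.
  by move=> k0; rewrite -gtz0_ge1 normr_gt0.
have hi : \prod_(z <- zeros R p) `|(Cpoly R q).[z]|
    <= s ^+ Zcount b eps p * M ^+ deg p.
  have -> : s ^+ Zcount b eps p * M ^+ deg p =
      \prod_(z <- zeros R p) ((if `[< cdisc b eps z >] then s else 1) * M).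
    rewrite big_split /= -big_mkcond /= !big_const_seq !iter_mulr_1.
    by rewrite count_predT size_zeros.
  rewrite big_seq [leRHS]big_seq; apply: ler_prod => z.
  rewrite zeros_root // normr_ge0 => /plam /qM Mz /=.
  case: asboolP => [/qs sz|_]; last by rewrite mul1r.
  by apply: le_trans sz _; rewrite ler_peMr.
suff lt1 : s ^+ Zcount b eps p * M ^+ deg p < 1.
  by have := le_lt_trans (le_trans lo hi) lt1; rewrite ltxx.
apply: (@le_lt_trans _ _ ((s * M ^+ N) ^+ Zcount b eps p)).
  rewrite exprMn -exprM ler_wpM2l ?exprn_ge0 //.
  exact: ler_weXn2l.
have sM0 : 0 <= s * M ^+ N := mulr_ge0 s0 (exprn_ge0 _ M0).
by rewrite exprn_ilt1 // -lt0n.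
Qed.

(** Continuity in the form used here: [q - q.[b]] is a multiple of ['X - b], and
    the cofactor is bounded on the disc of radius 1 around [b]. *)
Lemma horner_small_near (R : realType) (q : {poly R[i]}) (b s : R[i]) :
  `|q.[b]| < s ->
  exists2 eps : R, 0 < eps & forall z, cdisc b eps z -> `|q.[z]| <= s.
Proof.
move=> qs; have : root (q - q.[b]%:P) b by rewrite /root !hornerE subrr.
move=> /factor_theorem[r rE].
have [B BE] := poly_disk_bound r (`|b| + 1).
have B0 : 0 <= B.
  by apply: le_trans (BE 0 _); rewrite ?normr_ge0 // normr0 addr_ge0.
set t := s - `|q.[b]|; have t0 : 0 < t by rewrite subr_gt0.
have tB0 : 0 < t + B + 1.
  exact: ltr_wpDl (addr_ge0 (ltW t0) B0) ltr01.
(* this radius is at most 1, and times [B] it is at most [t] *)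
set e := t / (t + B + 1); have e0 : 0 < e by rewrite divr_gt0.
have eE : (complex.Re e)%:C%C = e by rewrite RRe_real // gtr0_real.
exists (complex.Re e); first by rewrite -ltcR eE.
rewrite /cdisc eE /= => z ze.
have zb : `|z| <= `|b| + 1.
  rewrite -[z](subrK b) (le_trans (ler_normD _ _)) // addrC lerD2l.
  apply: le_trans ze _; rewrite ler_pdivrMr // mul1r -addrA lerDl.
  by rewrite addr_ge0.
have -> : q.[z] = r.[z] * (z - b) + q.[b].
  have := congr1 (fun u => u.[z]) rE; rewrite !hornerE => /eqP.
  by rewrite subr_eq => /eqP.
apply: le_trans (ler_normD _ _) _; rewrite -lerBrDr normrM -/t.
apply: (@le_trans _ _ (B * e)); first by rewrite ler_pM ?BE.
rewrite mulrA ler_pdivrMr // mulrC ler_pM2l //.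
by rewrite addrAC lerDr addr_ge0 // ltW.
Qed.

Lemma cdisc_isolated (R : realType) (b : R[i]) (rs : seq R[i]) :
  exists2 eps : R, 0 < eps & forall z, z \in rs -> cdisc b eps z -> z = b.
Proof.
elim: rs => [|w rs [e e0 eP]]; first by exists 1.
have [->|wb] := eqVneq w b.
  by exists e => // z; rewrite inE => /predU1P[->|/eP].
have [r r0 rE] : exists2 r : R, 0 < r & r%:C%C = `|w - b|.
  have nE : (complex.Re `|w - b|)%:C%C = `|w - b|.
    by rewrite RRe_real // normr_real.
  by exists (complex.Re `|w - b|); rewrite // -ltcR nE normr_gt0 subr_eq0.
exists (Num.min e (r / 2)); first by rewrite lt_min e0 divr_gt0.
move=> z; rewrite inE /cdisc /= => /predU1P[->|/eP zb] h.
  move: h; rewrite -rE lecR le_min => /andP[_ h2].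
  by exfalso; move: r0 h2; lra.
by apply: zb; apply: le_trans h _; rewrite lecR ge_min lexx.
Qed.

Lemma cdiscW (R : realType) (c : R[i]) (r r' : R) (z : R[i]) :
  r <= r' -> cdisc c r z -> cdisc c r' z.
Proof. by move=> rr h; apply: le_trans h _; rewrite lecR. Qed.

(** * Integer polynomials that are small at a point *)

Lemma norm_realC (R : realType) (x : R) : `|x%:C%C| = `|x|%:C%C.
Proof. by rewrite normc_def /= expr0n addr0 sqrtr_sqr. Qed.

Lemma norm_ReIm_le (R : realType) (z : R[i]) :
  `|z| <= (`|complex.Re z| + `|complex.Im z|)%:C%C.
Proof.
rewrite [X in `|X| <= _]complexE (le_trans (ler_normD _ _)) // normrM.
rewrite !norm_realC rmorphD /= lerD2l.
by rewrite normc_def /= expr0n add0r expr1n sqrtr1 mul1r.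
Qed.

Lemma norm_Im_le (R : realType) (z : R[i]) : `|complex.Im z|%:C%C <= `|z|.
Proof.
by rewrite normc_def lecR -sqrtr_sqr ler_wsqrtr // lerDr sqr_ge0.
Qed.

Lemma eq_truncn_dist (R : realType) (x y : R) :
  0 <= x -> 0 <= y -> Num.truncn x = Num.truncn y -> `|x - y| <= 1.
Proof.
move=> /truncn_itv/andP[x1 x2] /truncn_itv/andP[y1 y2] e.
move: x1 x2; rewrite e -natr1 => x1 x2; move: y2; rewrite -natr1 => y2.
by rewrite ler_norml; apply/andP; split; lra.
Qed.

(** Pigeonhole on a grid of [L * L] squares of side [2 * B / L] covering the
    square of half-side [B]; the factor 4 bounds the diameter of a square by the
    sum of two sides. *)
Lemma box_principle (R : realType) (T : finType) (v : T -> R[i]) (B : R)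
    (L : nat) :
  (0 < L)%N -> (L * L < #|T|)%N -> (forall t, `|v t| < B%:C%C) ->
  exists t t' : T, t != t' /\ `|v t - v t'| <= (4 * B / L%:R)%:C%C.
Proof.
move=> L0 LT vB.
have /card_gt0P[t0 _] : (0 < #|T|)%N := leq_ltn_trans (leq0n _) LT.
have B0 : 0 < B by rewrite -ltcR; apply: le_lt_trans (normr_ge0 _) (vB t0).
have Lr : 0 < L%:R :> R by rewrite ltr0n.
pose w x : R := (x + B) * (L%:R / (2 * B)).
have u0 : 0 < L%:R / (2 * B) by rewrite divr_gt0 // mulr_gt0.
have w0 x : `|x| < B -> 0 <= w x.
  by rewrite ltr_norml => /andP[x1 _]; rewrite mulr_ge0 ?(ltW u0) //; lra.
have wL x : `|x| < B -> (Num.truncn (w x) < L)%N.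
  move=> xB; rewrite truncn_lt_nat ?w0 //.
  rewrite /w mulrA ltr_pdivrMr ?mulr_gt0 // mulrC ltr_pM2l //.
  by move: xB; rewrite ltr_norml => /andP[_]; lra.
have wE x y : `|x| < B -> `|y| < B -> Num.truncn (w x) = Num.truncn (w y) ->
    `|x - y| <= 2 * B / L%:R.
  move=> xB yB e; have := eq_truncn_dist (w0 _ xB) (w0 _ yB) e.
  rewrite /w -mulrBl (_ : x + B - (y + B) = x - y); last by ring.
  rewrite normrM (gtr0_norm u0) -ler_pdivlMr // => /le_trans; apply.
  by rewrite mul1r invf_div.
have ReB t : `|complex.Re (v t)| < B.
  by rewrite -ltcR; apply: le_lt_trans (normc_ge_Re _) (vB t).
have ImB t : `|complex.Im (v t)| < B.
  by rewrite -ltcR; apply: le_lt_trans (norm_Im_le _) (vB t).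
pose f t : 'I_L * 'I_L :=
  (Ordinal (wL _ (ReB t)), Ordinal (wL _ (ImB t))).
have /injectivePn[t [t' tt' [e1 e2]]] : ~~ injectiveb f.
  apply/negP => /injectiveP /leq_card.
  by rewrite card_prod !card_ord leqNgt LT.
exists t, t'; split=> //; apply: le_trans (norm_ReIm_le _) _; rewrite lecR.
rewrite !raddfB /= (_ : 4 * B / L%:R = 2 * B / L%:R + 2 * B / L%:R).
  by rewrite lerD ?wE.
by rewrite -mulrDl; congr (_ / _); ring.
Qed.

Lemma norm_horner_le (R : realType) (n h : nat) (rho : R) (c : nat -> int)
    (z : R[i]) :
  (forall i, `|c i| <= h%:Z) -> `|z| <= rho%:C%C ->
  `|(\poly_(i < n) (c i)%:~R).[z]| <= (h%:R * \sum_(i < n) rho ^+ i)%:C%C.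
Proof.
move=> ch zr; rewrite horner_poly (le_trans (ler_norm_sum _ _ _)) //.
rewrite mulr_sumr rmorph_sum /=; apply: ler_sum => i _.
rewrite rmorphM rmorphXn /= normrM normrX ler_pM ?exprn_ge0 //.
  by rewrite -intr_norm rmorph_nat -[h%:R]/(h%:Z%:~R) ler_int.
by rewrite lerXn2r ?nnegrE //; apply: le_trans zr.
Qed.

Lemma Cpoly_poly (R : realType) (n : nat) (c : nat -> int) :
  Cpoly R (\poly_(i < n) c i) = \poly_(i < n) (c i)%:~R.
Proof.
apply/polyP => i; rewrite coef_map !coef_poly.
by case: ifP => //= _; rewrite rmorph0.
Qed.

Lemma dist_nat_le (x y h : nat) :
  (x <= h)%N -> (y <= h)%N -> `|x%:Z - y%:Z| <= h%:Z.
Proof. by lia. Qed.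

(** Siegel's argument: among the polynomials of degree at most [n] with
    nonnegative coefficients below [h], two take close values at [b]. Their
    difference [q] is small at [b] by a power of [h] of order [n / 2], whereas
    its size on a fixed disc grows only linearly in [h]. So once [n / 2] exceeds
    [N + 1], taking [h] large makes the weighted value at [b] less than 1. *)
Lemma small_int_poly (R : realType) (b : R[i]) (lambda : R) (N : nat) :
  0 < lambda ->
  exists (q : {poly int}) (M : R[i]), [/\ q != 0, 1 <= M,
    `|(Cpoly R q).[b]| * M ^+ N < 1 &
    forall z, cdisc 0 lambda z -> `|(Cpoly R q).[z]| <= M].
Proof.
move=> l0.
have [rho lr br] : exists2 rho : R, lambda <= rho & `|b| <= rho%:C%C.
  exists (Num.max lambda (complex.Re `|b|)); first by rewrite le_max lexx.
  rewrite -[leLHS]RRe_real ?normr_real // lecR le_max lexx orbT //.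
have rho0 : 0 <= rho := le_trans (ltW l0) lr.
(* [n = 2 k] gives [h ^ n.+1 > (h ^ k) ^ 2] polynomials for the grid, and
   [k = N + 2] makes [h * h ^+ N / h ^+ k] equal to [h^-1] *)
pose k := N.+2; pose n := (k + k)%N.
pose K : R := 1 + \sum_(i < n.+1) rho ^+ i.
have K1 : 1 <= K by rewrite lerDl sumr_ge0 // => i _; rewrite exprn_ge0.
have K0 : 0 < K := lt_le_trans ltr01 K1.
pose h := (Num.truncn (4 * K ^+ N.+1)).+1.
have hK : 4 * K ^+ N.+1 < h%:R := truncnS_gt _.
have h1 : (1 < h)%N.
  have : 1 <= K ^+ N.+1 by rewrite exprn_ege1.
  rewrite -(ltr_nat R); move: hK; lra.
have h0 : 0 < h%:R :> R by rewrite ltr0n.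
have lt_hK : h%:R * \sum_(i < n.+1) rho ^+ i < h%:R * K.
  by rewrite ltr_pM2l // ltrDr.
pose c (f : {ffun 'I_n.+1 -> 'I_h}) (i : nat) : int := (f (inord i))%:Z.
pose v f : R[i] := (\poly_(i < n.+1) (c f i)%:~R).[b].
have vB f : `|v f| < (h%:R * K)%:C%C.
  rewrite /v; apply: le_lt_trans (norm_horner_le _ _ br) _; last first.
    by rewrite ltcR; exact: lt_hK.
  by move=> i; rewrite ger0_norm // lez_nat ltnW.
have [||f [g [fg vfg]]] := @box_principle R _ v (h%:R * K) (h ^ k) _ _ vB.
- by rewrite expn_gt0 ltnW.
- by rewrite card_ffun !card_ord -expnD ltn_exp2l.
pose d i := c f i - c g i.
have vd : v f - v g = (\poly_(i < n.+1) (d i)%:~R).[b].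
  rewrite /v !horner_poly -sumrB; apply: eq_bigr => i _.
  by rewrite -mulrBl -rmorphB.
exists (\poly_(i < n.+1) d i), (h%:R * K)%:C%C; split.
- apply: contra fg => /eqP /polyP d0; apply/eqP/ffunP => i.
  have := d0 i; rewrite coef_poly coef0 ltn_ord /d /c inord_val => /eqP.
  by rewrite subr_eq0 => /eqP[] /val_inj.
- rewrite (_ : 1 = 1%:C%C) // lecR (le_trans K1) // ler_peMl ?(ltW K0) //.
  by rewrite ler1n ltnW.
- rewrite Cpoly_poly -vd -rmorphXn /=.
  apply: le_lt_trans (ler_wpM2r _ vfg) _.
    by rewrite ler0c exprn_ge0 // mulr_ge0 // ltW.
  rewrite -rmorphM (_ : 1 = 1%:C%C) // ltcR.
  have -> : 4 * (h%:R * K) / (h ^ k)%:R * (h%:R * K) ^+ N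
      = 4 * K ^+ N.+1 / h%:R :> R.
    rewrite natrX exprMn /k !exprS; field.
    by rewrite expf_neq0 gt_eqF.
  by rewrite ltr_pdivrMr // mul1r.
- move=> z; rewrite /cdisc /= subr0 Cpoly_poly => zl.
  have zr : `|z| <= rho%:C%C by apply: le_trans zl _; rewrite lecR.
  apply: le_trans (norm_horner_le _ _ zr) _; last first.
    by rewrite lecR; exact: ltW lt_hK.
  move=> i; rewrite /d /c.
  exact: dist_nat_le (ltnW (ltn_ord _)) (ltnW (ltn_ord _)).
Qed.

(** * Zeros near beta are sparse *)

(** The condition on [q] and [M] is open at [b], so it survives on a small disc;
    shrinking that disc further keeps the other zeros of [q] out of it. *)
Lemma sparse_near (R : realType) (b : R[i]) (lambda : R) (N : nat)
    (q : {poly int}) (M : R[i]) :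
  q != 0 -> 1 <= M -> `|(Cpoly R q).[b]| * M ^+ N < 1 ->
  (forall z, cdisc 0 lambda z -> `|(Cpoly R q).[z]| <= M) ->
  exists2 eps : R, 0 < eps &
    (forall z, root (Cpoly R q) z -> cdisc b eps z -> z = b) /\
    forall h, Pset lambda h ->
      (forall z : R[i], root (Cpoly R h) z -> ~~ root (Cpoly R q) z) ->
      (N * Zcount b eps h < deg h)%N.
Proof.
move=> q0 M1 qM qle; have MN0 : 0 < M ^+ N.
  by rewrite exprn_gt0 // (lt_le_trans ltr01).
have [s s1 s2] : exists2 s, `|(Cpoly R q).[b]| < s & s * M ^+ N < 1.
  rewrite -ltr_pdivlMr // in qM; have [lt1 lt2] := midf_lt qM.
  (* the midpoint of [`|(Cpoly R q).[b]|] and [(M ^+ N)^-1] *)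
  by eexists; first exact: lt1; rewrite -ltr_pdivlMr.
have [e1 e10 e1P] := horner_small_near s1.
have [rs rsE] := closed_field_poly_normal (Cpoly R q).
have [e2 e20 e2P] := cdisc_isolated b rs.
exists (Num.min e1 e2); first by rewrite lt_min e10.
split=> [z|h hP hq].
  have Cq0 : Cpoly R q != 0.
    rewrite -size_poly_eq0 size_map_inj_poly ?size_poly_eq0 //.
    exact: intr_inj.
  rewrite rsE rootZ ?lead_coef_eq0 // root_prod_XsubC => zrs zb.
  by apply: (e2P z zrs); apply: cdiscW zb; rewrite ge_min lexx orbT.
have s0 := le_trans (normr_ge0 _) (ltW s1).
apply: Zcount_sparse hP hq s0 M1 s2 _ qle => z zb.
by apply: e1P; apply: cdiscW zb; rewrite ge_min lexx.
Qed.

Lemma exists_inv_nat (R : realType) (d : R) : 0 < d ->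
  exists N : nat, 1 <= d * N%:R.
Proof.
move=> d0; exists (Num.truncn d^-1).+1.
by rewrite mulrC -ler_pdivrMr // mul1r ltW // truncnS_gt.
Qed.

(** If [b] is not an algebraic integer, it is a zero of no monic integer
    polynomial. So the factor [g] of [p] made of the zeros shared with [q] has
    no zero near [b], and dividing it out keeps the count near [b] without
    raising the degree: the quotient [h] contradicts [sparse_near]. *)
Lemma algebraic_integer_of_density (R : realType) (b : R[i])
    (lambda delta : R) :
  0 < lambda -> 0 < delta -> eta_at_set b lambda delta -> algebraic_integer b.
Proof.
move=> l0 d0 [_ dP]; have [//|nb] := pselect (algebraic_integer b); exfalso.
have [N dN] := exists_inv_nat d0.
have [q [M [q0 M1 qM qle]]] := small_int_poly b N l0.
have [eps eps0 [iso sparse]] := sparse_near q0 M1 qM qle.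
have [p [pm p0 plam] dp] := dP eps eps0.
have pN : (deg p <= N * Zcount b eps p)%N.
  rewrite -(ler_nat R) natrM; move: dp; rewrite ler_pdivlMr ?ltr0n // => dp.
  apply: (@le_trans _ _ (delta * N%:R * (deg p)%:R)); first by rewrite ler_peMl.
  by rewrite mulrAC mulrC ler_wpM2l.
have [g [h [ph [gm hm] gq hq]]] := split_common_zeros R q0 pm.
have Zg : Zcount b eps g = 0%N.
  apply/eqP; rewrite -leqn0 leqNgt -has_count; apply/hasP => -[z].
  rewrite zeros_root // => gz /asboolP zb; apply: nb; exists g => //.
  by rewrite -(iso z (gq z gz) zb).
have Zp : Zcount b eps p = Zcount b eps h by rewrite ph ZcountM // Zg.
have dph : deg p = (deg g + deg h)%N by rewrite ph deg_monicM.
have Zh : (Zcount b eps h <= deg h)%N by rewrite -(size_zeros R hm) count_size.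
have h0 : (0 < deg h)%N.
  apply: leq_trans Zh; rewrite -Zp.
  by move: (leq_trans p0 pN); rewrite muln_gt0 => /andP[].
have hP : Pset lambda h.
  by split=> // z hz; apply: plam; rewrite ph CpolyM rootM hz orbT.
by have := sparse h hP hq; move: pN; rewrite Zp dph; lia.
Qed.

(** * The minimal polynomial of an algebraic integer *)

(** The comparison is with all integer polynomials vanishing at [b], not only
    the monic ones, so that it applies to derivatives, to remainders and to
    rational polynomials with cleared denominators. *)
Definition minimal_over_int (R : realType) (b : R[i]) (m : {poly int}) : Prop :=
  [/\ m \is monic, root (Cpoly R m) b &
     forall q : {poly int}, q != 0 -> root (Cpoly R q) b ->
       (size m <= size q)%N].

(** Descent: if an integer polynomial [q] smaller than the monic [p] vanishes at
    [b], then [p] has a monic factor no larger than [q] that vanishes at [b]. *)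
Lemma minimal_int_poly (R : realType) (b : R[i]) :
  algebraic_integer b -> exists m : {poly int}, minimal_over_int b m.
Proof.
move=> [p pm pb]; move: p pm pb; apply: monic_ind => p pm IH pb.
have [[q [q0 qb qp]]|no] := pselect (exists q : {poly int},
    [/\ q != 0, root (Cpoly R q) b & (size q < size p)%N]); last first.
  exists p; split=> // q q0 qb; rewrite leqNgt; apply/negP => qp.
  by apply: no; exists q.
have [g [h [_ [gm _] gb gq _]]] := common_factor pm q0 pb qb.
apply: (IH g gm _ gb); rewrite /deg -!subn1 ltn_sub2r //.
  by rewrite (leq_ltn_trans _ qp) // size_poly_gt0.
exact: leq_ltn_trans gq qp.
Qed.

Lemma deg_minimal (R : realType) (b : R[i]) (m : {poly int}) (p : {poly rat}) :
  minimal_over_int b m -> minimal_polynomial b p -> deg p = deg m.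
Proof.
move=> [mm mb mmin] [pm pb pmin].
have ratrE (q : {poly int}) : map_poly ratr (map_poly intr q : {poly rat})
    = Cpoly R q.
  by rewrite -map_poly_comp; apply: eq_map_poly => z /=; rewrite ratr_int.
have sizeQ (q : {poly int}) : size (map_poly intr q : {poly rat}) = size q.
  by rewrite size_map_inj_poly //; exact: intr_inj.
apply/eqP; rewrite eqn_leq; apply/andP; split.
  rewrite /deg -(sizeQ m); apply: pmin; first exact: monic_map.
  by rewrite ratrE.
have [q [a a0 pq]] := rat_poly_scale p.
have a0' : (a%:~R : rat)^-1 != 0 by rewrite invr_eq0 intr_eq0.
have sq : size q = size p by rewrite pq size_scale // sizeQ.
rewrite /deg -sq -!subn1 leq_sub2r // mmin //.
  by rewrite -size_poly_eq0 sq size_poly_eq0 monic_neq0.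
move: pb; rewrite pq map_polyZ ratrE rootZ //.
by rewrite fmorph_eq0.
Qed.

(** The derivative of [m] is too small to vanish at [b], so [b] is a simple
    zero of [m]. *)
Lemma Zcount_minimal (R : realType) (b : R[i]) (m : {poly int}) (eps : R) :
  minimal_over_int b m -> 0 < eps ->
  (forall z, root (Cpoly R m) z -> cdisc b eps z -> z = b) ->
  Zcount b eps m = 1%N.
Proof.
move=> [mm mb mmin] eps0 iso.
have -> : Zcount b eps m = count_mem b (zeros R m).
  apply: eq_in_count => z; rewrite zeros_root //= => mz.
  apply/asboolP/eqP => [/iso->//|->].
  by rewrite /cdisc /= subrr normr0 ler0c ltW.
have bz : b \in zeros R m by rewrite zeros_root.
have /permP/(_ (pred1 b)) -> := perm_to_rem bz.
rewrite /= eqxx; congr (_.+1); apply/count_memPn/negP => b2.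
have /mmin : root (Cpoly R m^`()) b.
  rewrite /Cpoly -deriv_map -/(Cpoly R m) zerosE //.
  rewrite (perm_big _ (perm_to_rem bz)) big_cons derivM derivXsubC mul1r /root.
  rewrite !hornerE subrr mul0r addr0.
  by rewrite -[_ == 0]/(root _ b) root_prod_XsubC.
have m0 := monic_neq0 mm.
rewrite leqNgt (lt_size_deriv m0) => H; apply: notF; apply: H.
rewrite -size_poly_gt0 polyorder.size_deriv.
exact: deg_root_gt0 mm mb.
Qed.

(** This is the irreducibility of [m]: a zero shared with [h] splits [m] into
    two factors, one of them inherits the zero [b], and it can be neither the
    one whose zeros are zeros of [h] nor the one of smaller degree. *)
Lemma minimal_coprime (R : realType) (b : R[i]) (m h : {poly int}) (z : R[i]) :
  minimal_over_int b m -> h \is monic -> ~~ root (Cpoly R h) b ->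
  root (Cpoly R h) z ->
  ~~ root (Cpoly R m) z.
Proof.
move=> [mm mb mmin] hm hb hz; apply/negP => mz.
have [g [g' [mE [gm gm'] gz _ gh]]] := common_factor mm (monic_neq0 hm) mz hz.
move: mb; rewrite mE CpolyM rootM => /orP[/gh|g'b].
  by rewrite (negbTE hb).
have := mmin _ (monic_neq0 gm') g'b; have := deg_root_gt0 gm gz.
rewrite mE size_monicM ?monic_neq0 // /deg.
by case: (size g) => // a; case: (size g') => [|c]; lia.
Qed.

(** Here [p] is [m ^+ k * h], and each factor [m] contributes one zero near [b]
    for [deg m] units of degree. *)
Lemma minimal_power_split (R : realType) (b : R[i]) (m : {poly int}) (eps : R) :
  minimal_over_int b m -> Zcount b eps m = 1%N ->
  forall p, p \is monic -> exists (k : nat) (h : {poly int}),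
    [/\ h \is monic, ~~ root (Cpoly R h) b,
       forall z : R[i], root (Cpoly R h) z -> root (Cpoly R p) z,
       Zcount b eps p = (k + Zcount b eps h)%N &
       deg p = (k * deg m + deg h)%N].
Proof.
move=> [mm mb mmin] Zm; apply: monic_ind => p pm IH.
have [pb|pb] := boolP (root (Cpoly R p) b); last by exists 0%N, p; split.
have pE := Pdiv.IdomainMonic.divp_eq mm p.
have r0 : p %% m = 0.
  apply/eqP; apply: contraTT (ltn_modpN0 p (monic_neq0 mm)) => r0.
  rewrite -leqNgt mmin //.
  have -> : p %% m = p - p %/ m * m by rewrite {2}pE addrC addKr.
  rewrite /Cpoly rmorphB rmorphM /root !hornerE (rootP pb) (rootP mb).
  by rewrite mulr0 subrr.
rewrite r0 addr0 in pE.
have qm : p %/ m \is monic by rewrite -(monicMr _ mm) -pE.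
have [] := IH _ qm.
  rewrite [in X in (_ < X)%N]pE deg_monicM // -[X in (X < _)%N]addn0 ltn_add2l.
  exact: deg_root_gt0 mm mb.
move=> k [h [hm hb hq Zq dq]]; exists k.+1, h; split=> //.
- by move=> z /hq qz; rewrite pE CpolyM rootM qz.
- by rewrite pE ZcountM // Zq Zm addn1 addSn.
- by rewrite pE deg_monicM // dq mulSn; lia.
Qed.

(** In [m ^+ k * h], the factor [m ^+ k] has density exactly [(deg m)^-1] near
    [b]. A larger density of the whole would force [h] to have at least the
    density [delta] near [b]; but [h] and [m] have no common zero and [m]
    vanishes at [b], so [sparse_near] applied to [m] forbids this. *)
Lemma density_le_minimal (R : realType) (b : R[i]) (m : {poly int})
    (lambda delta : R) :
  minimal_over_int b m -> 0 < lambda -> eta_at_set b lambda delta ->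
  delta <= (deg m)%:R^-1.
Proof.
move=> mP l0 [_ dP]; have [mm mb _] := mP; rewrite leNgt; apply/negP => md.
have dm0 : (0 < deg m)%N := deg_root_gt0 mm mb.
have dmR : 0 < (deg m)%:R :> R by rewrite ltr0n.
have d0 : 0 < delta by apply: lt_trans md; rewrite invr_gt0.
have [N dN] := exists_inv_nat d0.
have [M MP] := poly_disk_bound (Cpoly R m) lambda%:C%C.
have M0 : 0 <= M.
  by apply: le_trans (MP 0 _); rewrite ?normr_ge0 // normr0 ler0c ltW.
have mM : `|(Cpoly R m).[b]| * (M + 1) ^+ N < 1.
  by rewrite (rootP mb) normr0 mul0r.
have [||eps eps0 [iso sparse]] :=
  sparse_near (lambda := lambda) (monic_neq0 mm) _ mM.
- by rewrite lerDr.
- by move=> z; rewrite /cdisc /= subr0 => /MP /le_trans; apply; rewrite lerDl.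
have [p [pm p0 plam] dp] := dP eps eps0.
have [k [h [hm hb hp Zp degp]]] :=
  minimal_power_split mP (Zcount_minimal mP eps0 iso) pm.
move: dp; rewrite ler_pdivlMr ?ltr0n // Zp degp !natrD natrM => dp.
have dm : 1 < delta * (deg m)%:R by rewrite -ltr_pdivrMr // mul1r.
have kd : k%:R <= delta * (k%:R * (deg m)%:R).
  by rewrite mulrCA ler_peMr // ltW.
(* when [h] is constant, the density of [p] is exactly [(deg m)^-1] *)
have [h0|h0] := posnP (deg h).
  have Zh0 : Zcount b eps h = 0%N.
    by apply/eqP; rewrite -leqn0 -h0 -(size_zeros R hm) count_size.
  have k0 : (0 < k)%N by move: p0; rewrite degp h0 addn0 muln_gt0 => /andP[].
  have : k%:R < delta * (k%:R * (deg m)%:R) by rewrite mulrCA ltr_pMr ?ltr0n.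
  by move: dp; rewrite Zh0 h0 !addr0 => /le_lt_trans H /H; rewrite ltxx.
have hP : Pset lambda h by split=> // z /hp; apply: plam.
have := sparse h hP (fun z => minimal_coprime mP hm hb).
rewrite -(ltr_nat R) natrM; apply/negP; rewrite -leNgt.
have dh : delta * (deg h)%:R <= (Zcount b eps h)%:R.
  by move: dp kd; rewrite mulrDr; lra.
apply: (@le_trans _ _ (delta * N%:R * (deg h)%:R)); first by rewrite ler_peMl.
by rewrite mulrAC mulrC ler_wpM2l.
Qed.

(** The polynomial [m] itself attains the density for every [eps]. *)
Lemma minimal_density_mem (R : realType) (b : R[i]) (m : {poly int}) :
  minimal_over_int b m ->
  exists2 lambda : R, 0 < lambda & eta_at_set b lambda (deg m)%:R^-1.
Proof.
move=> [mm mb _].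
have [lambda l0 lP] : exists2 lambda : R, 0 < lambda &
    forall z, z \in zeros R m -> cdisc 0 lambda z.
  elim: (zeros R m) => [|w s [l l0 lP]]; first by exists 1.
  exists (Num.max l (complex.Re `|w|)); first by rewrite lt_max l0.
  move=> z; rewrite inE => /predU1P[->|/lP zl]; last first.
    by apply: cdiscW zl; rewrite le_max lexx.
  rewrite /cdisc /= subr0 -[leLHS]RRe_real ?normr_real // lecR le_max lexx.
  by rewrite orbT.
exists lambda => //; split=> [|eps eps0]; first by rewrite invr_ge0.
exists m; first split=> //; first exact: deg_root_gt0 mm mb.
  by move=> z mz; apply: lP; rewrite zeros_root.
rewrite ler_peMl ?invr_ge0 // ler1n -has_count; apply/hasP; exists b.
  by rewrite zeros_root.
by apply/asboolP; rewrite /cdisc /= subrr normr0 ler0c ltW.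
Qed.

(** * The value of eta *)

Lemma eta_ub (R : realType) (b : R[i]) (lambda delta : R) :
  0 < lambda -> eta_at_set b lambda delta -> delta <= eta b.
Proof.
move=> l0 d; apply: (@le_trans _ _ (eta_at b lambda)).
  exact: ub_le_sup (has_sup_eta_at b l0).2 _ d.
by apply: ub_le_sup (has_sup_eta b).2 _ _; exists lambda.
Qed.

Lemma eta_gtP (R : realType) (b : R[i]) (x : R) : x < eta b ->
  exists lambda delta : R,
    [/\ 0 < lambda, eta_at_set b lambda delta & x < delta].
Proof.
move=> /(sup_gt (has_sup_eta b).1)[_ [lambda /= l0 <-]].
move=> /(sup_gt (has_sup_eta_at b l0).1)[delta dP xd].
by exists lambda, delta.
Qed.

Theorem theorem3p5 (R : realType) (beta : R[i]) :
  (eta beta <> 0 -> algebraic_integer beta) /\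
  (algebraic_integer beta ->
   forall p : {poly rat}, minimal_polynomial beta p ->
   eta beta = (deg p)%:R^-1).
Proof.
split=> [eta0|ib p pmin].
  have eta_ge0 : 0 <= eta beta.
    apply: (@eta_ub _ _ 1) => //; split=> // eps _.
    by exists 'X; [exact: Pset_X|rewrite divr_ge0].
  have eta_gt0 : 0 < eta beta.
    by rewrite lt_neqAle eq_sym eta_ge0 andbT; apply/eqP.
  have [lambda [delta [l0 dP d0]]] := eta_gtP eta_gt0.
  exact: algebraic_integer_of_density l0 d0 dP.
have [m mP] := minimal_int_poly ib; rewrite (deg_minimal mP pmin).
apply/eqP; rewrite eq_le; apply/andP; split.
  rewrite leNgt; apply/negP => /eta_gtP[lambda [delta [l0 dP]]].
  by rewrite ltNge (density_le_minimal mP l0 dP).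
have [lambda l0 dP] := minimal_density_mem mP.
exact: eta_ub l0 dP.
Qed.
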